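(* If $H:T(M)\times_ME\to T(E)$ is a horizontal connection on a differential bundle $\mathsf{q}=(q:E\to M,+_q,0_q,\lambda)$ in a tangent category, then $$(c_M\times1)\,T(H)\,c_E:\ T^2(M)\times_{T(M)}T(E)\to T^2(E)$$ is a horizontal connection on $T(\mathsf{q})=(T(q),T(+_q),T(0_q),T(\lambda)c)$. Here the domain is the pullback of $p_{T(M)}:T^2(M)\to T(M)$ and $T(q):T(E)\to T(M)$, and $c_M\times1$ maps it to $T(T(M)\times_ME)$, the pullback of $T(p_M)$ and $T(q)$.
   Context: Conventions: composites are written in diagrammatic order ($fg$ means first $f$, then $g$). $\langle f,g\rangle$ is the induced map into a pullback, $\pi_0,\pi_1$ are projections, $h\times k=\langle\pi_0h,\pi_1k\rangle$ between pullbacks. Component subscripts of natural transformations are often omitted. An additive bundle over $M$ is a map $q:E\to M$ whose finite wide pullbacks $E_n$ along itself exist, with maps $+_q:E_2\to E$, $0_q:M\to E$ making $q$ a commutative monoid in the slice over $M$. An additive bundle morphism $(f_1,f_0)$ from $q:E\to M$ to $q':E'\to M'$ is a pair $f_1:E\to E'$, $f_0:M\to M'$ with $f_1q'=qf_0$ preserving addition and zero. A tangent category is a category with a functor $T$ and natural transformations $p:T\to 1$, $0:1\to T$, $+:T_2\to T$, $\ell:T\to T^2$, $c:T^2\to T^2$ such that: each $(p_M,+_M,0_M)$ is an additive bundle, the wide pullbacks $T_nM$ of $p_M$ exist and are preserved by each $T^k$; $(\ell_M,0_M)$ is an additive bundle morphism from $(p_M,+_M,0_M)$ to $(T(p_M),T(+_M),T(0_M))$;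 $(c_M,1)$ is an additive bundle morphism from $(T(p_M),T(+_M),T(0_M))$ to $(p_{TM},+_{TM},0_{TM})$; $c^2=1$, $\ell c=\ell$, $\ell_M\ell_{TM}=\ell_MT(\ell_M)$, $T(c)cT(c)=cT(c)c$, $\ell_{TM}T(c_M)c_{TM}=c_MT(\ell_M)$; and the square with top $\langle\pi_0\ell,\pi_10\rangle T(+):T_2M\to T^2M$, left $\pi_0p=\pi_1p$, right $T(p)$, bottom $0_M$ is a pullback preserved by each $T^k$. A differential bundle $\mathsf{q}=(q:E\to M,+_q,0_q,\lambda)$ is an additive bundle with a lift $\lambda:E\to T(E)$ such that: the wide pullbacks $E_n$ are preserved by each $T^k$; for all $n,m$ the pullback of $E_n\to M$ along $T_mM\to M$ exists and is preserved by each $T^k$; $(\lambda,0_M)$ is an additive bundle morphism from $q$ to $(T(q),T(+_q),T(0_q))$; $(\lambda,0_q)$ is an additive bundle morphism from $q$ to $(p_E,+_E,0_E)$; with $\mu:=\langle\pi_0\lambda,\pi_10\rangle T(+_q):E_2\to T(E)$, the square with top $\mu$, left $\pi_0q=\pi_1q:E_2\to M$, right $T(q)$, bottom $0_M$ is a pullback (preserved by each $T^k$); and $\lambda\ell_E=\lambda T(\lambda)$. Then $T(\mathsf{q})$, with lift $T(\lambda)c_E$, is again a differential bundle. A horizontal connection on a differential bundle $\mathsf{q}$ is a map $H:T(M)\times_ME\to T(E)$ (pullback of $p_M$ and $q$, $\pi_0$ to $T(M)$, $\pi_1$ to $E$) with $HT(q)=\pi_0$, $Hp=\pi_1$, $H\ell=(\ell\times0)T(H)$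 and $HT(\lambda)c=(0\times\lambda)T(H)$ (i.e. a section of $\langle T(q),p\rangle$ that is linear for both bundle structures). *)

(* Defs.v *)
From mathcomp Require Import all_boot boolp.

Set Implicit Arguments.
Unset Strict Implicit.
Unset Printing Implicit Defensive.

Declare Scope cat_scope.
Delimit Scope cat_scope with cat.
Local Open Scope cat_scope.

Record category := Category {
  obj :> Type;
  hom : obj -> obj -> Type;
  idm : forall A, hom A A;
  compm : forall A B D, hom A B -> hom B D -> hom A D;
  comp1m : forall A B (f : hom A B), compm (idm A) f = f;
  compm1 : forall A B (f : hom A B), compm f (idm B) = f;
  compmA : forall A B D G (f : hom A B) (g : hom B D) (h : hom D G),
    compm f (compm g h) = compm (compm f g) h }.

Arguments hom {c} A B.
Arguments idm {c} A.
Arguments compm {c A B D} f g.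

(* Diagrammatic order: [f \; g] is first [f], then [g]. *)
Notation "f \; g" := (compm f g) : cat_scope.

Record functor (C D : category) := Functor {
  fobj :> C -> D;
  fmap : forall A B, hom A B -> hom (fobj A) (fobj B);
  fmap1 : forall A, fmap (idm A) = idm (fobj A);
  fmapM : forall A B G (f : hom A B) (g : hom B G),
    fmap (f \; g) = fmap f \; fmap g }.

Arguments fmap {C D} F {A B} f : rename.

Definition id_functor (C : category) : functor C C :=
  @Functor C C (fun A => A) (fun _ _ f => f)
    (fun _ => erefl) (fun _ _ _ _ _ => erefl).

Lemma comp_fmap1 (C D G : category) (F : functor C D) (K : functor D G) A :
  fmap K (fmap F (idm A)) = idm (K (F A)).
Proof. by rewrite !fmap1. Qed.

Lemma comp_fmapM (C D G : category) (F : functor C D) (K : functor D G)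
    A B B' (f : hom A B) (g : hom B B') :
  fmap K (fmap F (f \; g)) = fmap K (fmap F f) \; fmap K (fmap F g).
Proof. by rewrite !fmapM. Qed.

Definition comp_functor (C D G : category) (F : functor C D) (K : functor D G) :
    functor C G :=
  @Functor C G (fun A => K (F A)) (fun _ _ f => fmap K (fmap F f))
    (comp_fmap1 F K) (@comp_fmapM C D G F K).

Fixpoint iter_functor (C : category) (F : functor C C) (k : nat) : functor C C :=
  if k is k'.+1 then comp_functor F (iter_functor F k') else id_functor C.

Record nattrans (C D : category) (F G : functor C D) := Nattrans {
  nt_app :> forall A, hom (F A) (G A);
  nt_nat : forall A B (f : hom A B), nt_app A \; fmap G f = fmap F f \; nt_app B }.

Section Pullbacks.
Variable C : category.

Definition is_pullback (A B M P : C) (f : hom A M) (g : hom B M)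
    (p0 : hom P A) (p1 : hom P B) : Prop :=
  p0 \; f = p1 \; g /\
  forall (Y : C) (u : hom Y A) (v : hom Y B), u \; f = v \; g ->
    exists! h : hom Y P, h \; p0 = u /\ h \; p1 = v.

Record pullback (A B M : C) (f : hom A M) (g : hom B M) := Pullback {
  pb_obj :> C;
  pb_fst : hom pb_obj A;
  pb_snd : hom pb_obj B;
  pb_ok : is_pullback f g pb_fst pb_snd }.

(* The [n]-fold wide pullback of [q] along itself. The leg [b] to the base is
   part of the cone, so that the case [n = 0] is the base [M] itself. *)
Definition is_wide_pullback (n : nat) (E M P : C) (q : hom E M)
    (b : hom P M) (pr : 'I_n -> hom P E) : Prop :=
  (forall i, pr i \; q = b) /\
  forall (Y : C) (u : hom Y M) (v : 'I_n -> hom Y E),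
    (forall i, v i \; q = u) ->
    exists! h : hom Y P, h \; b = u /\ forall i, h \; pr i = v i.

Record wide_pullback (n : nat) (E M : C) (q : hom E M) := WidePullback {
  wp_obj :> C;
  wp_base : hom wp_obj M;
  wp_pr : 'I_n -> hom wp_obj E;
  wp_ok : is_wide_pullback q wp_base wp_pr }.

Section PbPair.
Variables (A B M : C) (f : hom A M) (g : hom B M) (P : pullback f g).
Variables (Y : C) (u : hom Y A) (v : hom Y B) (e : u \; f = v \; g).

Lemma pb_pair_ex : exists h : hom Y P, h \; pb_fst P = u /\ h \; pb_snd P = v.
Proof. by have [_ /(_ _ _ _ e) [h [hP _]]] := pb_ok P; exists h. Qed.

Definition pb_pair : hom Y P := sval (cid pb_pair_ex).

Lemma pb_pairK0 : pb_pair \; pb_fst P = u.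
Proof. by rewrite /pb_pair; case: cid => h []. Qed.

Lemma pb_pairK1 : pb_pair \; pb_snd P = v.
Proof. by rewrite /pb_pair; case: cid => h []. Qed.

End PbPair.

Lemma pb_ext (A B M : C) (f : hom A M) (g : hom B M) (P : pullback f g)
    (Y : C) (h k : hom Y P) :
  h \; pb_fst P = k \; pb_fst P -> h \; pb_snd P = k \; pb_snd P -> h = k.
Proof.
move=> e0 e1; have [eP uP] := pb_ok P.
have e : (h \; pb_fst P) \; f = (h \; pb_snd P) \; g by rewrite -!compmA eP.
have [l [_ lu]] := uP _ _ _ e.
by rewrite -(lu h) // -(lu k) // e0 e1.
Qed.

(* [h * k] between pullbacks. *)
Definition pb_map (A B M A' B' M' : C) (f : hom A M) (g : hom B M)
    (f' : hom A' M') (g' : hom B' M') (P : pullback f g) (P' : pullback f' g')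
    (h : hom A A') (k : hom B B')
    (e : (pb_fst P \; h) \; f' = (pb_snd P \; k) \; g') : hom P P' :=
  pb_pair P' e.

Section WpLift.
Variables (n : nat) (E M : C) (q : hom E M) (W : wide_pullback n q).
Variables (Y : C) (u : hom Y M) (v : 'I_n -> hom Y E).
Hypothesis e : forall i, v i \; q = u.

Lemma wp_lift_ex :
  exists h : hom Y W, h \; wp_base W = u /\ forall i, h \; wp_pr W i = v i.
Proof. by have [_ /(_ _ _ _ e) [h [hP _]]] := wp_ok W; exists h. Qed.

Definition wp_lift : hom Y W := sval (cid wp_lift_ex).

Lemma wp_liftKb : wp_lift \; wp_base W = u.
Proof. by rewrite /wp_lift; case: cid => h []. Qed.

Lemma wp_liftK i : wp_lift \; wp_pr W i = v i.
Proof. by rewrite /wp_lift; case: cid => h []. Qed.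

End WpLift.

Section WpExt.
Variables (n : nat) (E M : C) (q : hom E M) (W : wide_pullback n q).

Lemma wp_prq i : wp_pr W i \; q = wp_base W.
Proof. by have [] := wp_ok W. Qed.

Lemma wp_ext (Y : C) (h k : hom Y W) :
  h \; wp_base W = k \; wp_base W ->
  (forall i, h \; wp_pr W i = k \; wp_pr W i) -> h = k.
Proof.
move=> e0 e1; have [eP uP] := wp_ok W.
have e i : (h \; wp_pr W i) \; q = h \; wp_base W by rewrite -!compmA eP.
have [l [_ lu]] := uP _ _ _ e.
by rewrite -(lu h) // -(lu k) //; split=> [|i]; rewrite ?e0 ?e1.
Qed.

End WpExt.

Definition wp_pr0 (E M : C) (q : hom E M) (W : wide_pullback 2 q) : hom W E :=
  wp_pr W ord0.
Definition wp_pr1 (E M : C) (q : hom E M) (W : wide_pullback 2 q) : hom W E :=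
  wp_pr W ord_max.

Section WpPair.
Variables (E M : C) (q : hom E M) (W : wide_pullback 2 q).

Lemma wp_pr01 : wp_pr0 W \; q = wp_pr1 W \; q.
Proof. by rewrite !wp_prq. Qed.

Lemma wp_ext2 (Y : C) (h k : hom Y W) :
  h \; wp_pr0 W = k \; wp_pr0 W -> h \; wp_pr1 W = k \; wp_pr1 W -> h = k.
Proof.
move=> e0 e1; apply: wp_ext; first by rewrite -(wp_prq W ord0) !compmA e0.
case=> [[|[|j]] im]; last by [].
  by rewrite (_ : Ordinal im = ord0) //; apply: val_inj.
by rewrite (_ : Ordinal im = ord_max) //; apply: val_inj.
Qed.

Variables (Y : C) (u v : hom Y E) (e : u \; q = v \; q).

Lemma wp_pair_subproof (i : 'I_2) : (if i == ord0 then u else v) \; q = u \; q.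
Proof. by case: ifP. Qed.

Definition wp_pair : hom Y W := wp_lift W wp_pair_subproof.

Lemma wp_pairK0 : wp_pair \; wp_pr0 W = u.
Proof. exact: wp_liftK. Qed.

Lemma wp_pairK1 : wp_pair \; wp_pr1 W = v.
Proof. exact: wp_liftK. Qed.

End WpPair.

(* The map [E_n -> E'_n] induced by a commutative square. *)
Section WpMap.
Variables (n : nat) (E M E' M' : C) (q : hom E M) (q' : hom E' M').
Variables (W : wide_pullback n q) (W' : wide_pullback n q').
Variables (f1 : hom E E') (f0 : hom M M') (e : f1 \; q' = q \; f0).

Lemma wp_map_subproof i : (wp_pr W i \; f1) \; q' = wp_base W \; f0.
Proof. by rewrite -compmA e compmA wp_prq. Qed.

Definition wp_map : hom W W' := wp_lift W' wp_map_subproof.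

Lemma wp_mapKb : wp_map \; wp_base W' = wp_base W \; f0.
Proof. exact: wp_liftKb. Qed.

Lemma wp_mapK i : wp_map \; wp_pr W' i = wp_pr W i \; f1.
Proof. exact: wp_liftK. Qed.

End WpMap.

Section Sums.
Variables (E M : C) (q : hom E M) (W : wide_pullback 2 q).
Variables (add : hom W E) (zero : hom M E).
Hypotheses (addq : add \; q = wp_base W) (zeroq : zero \; q = idm M).

Lemma unit_q : idm E \; q = (q \; zero) \; q.
Proof. by rewrite -compmA zeroq compm1 comp1m. Qed.

Lemma sum_q (Y : C) (u v : hom Y E) (e : u \; q = v \; q) :
  (wp_pair W e \; add) \; q = u \; q.
Proof. by rewrite -compmA addq -(wp_prq W ord0) compmA wp_pairK0. Qed.

Variables (Y : C) (u v w : hom Y E) (euv : u \; q = v \; q) (evw : v \; q = w \; q).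

Lemma suml_q : (wp_pair W euv \; add) \; q = w \; q.
Proof. by rewrite sum_q euv evw. Qed.

Lemma sumr_q : u \; q = (wp_pair W evw \; add) \; q.
Proof. by rewrite sum_q euv. Qed.

End Sums.

Lemma wp_prqE (n : nat) (E M : C) (q : hom E M) (W : wide_pullback n q) i j :
  wp_pr W i \; q = wp_pr W j \; q.
Proof. by rewrite !wp_prq. Qed.

(* The fibre powers are part of the structure, since the type of [+_q] depends on
   [E_2]; the monoid laws are the usual diagrams over [E_2], [E] and [E_3]. *)
Record additive_bundle (E M : C) (q : hom E M) := AdditiveBundle {
  ab_pow : forall n, wide_pullback n q;
  ab_add : hom (ab_pow 2) E;
  ab_zero : hom M E;
  ab_addq : ab_add \; q = wp_base (ab_pow 2);
  ab_zeroq : ab_zero \; q = idm M;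
  ab_addC : wp_pair (ab_pow 2) (esym (wp_pr01 (ab_pow 2))) \; ab_add = ab_add;
  ab_add0 : wp_pair (ab_pow 2) (unit_q ab_zeroq) \; ab_add = idm E;
  ab_addA :
    let e01 := wp_prqE (ab_pow 3) ord0 (Ordinal (isT : 1 < 3)) in
    let e12 := wp_prqE (ab_pow 3) (Ordinal (isT : 1 < 3)) ord_max in
    wp_pair (ab_pow 2) (suml_q ab_addq e01 e12) \; ab_add =
    wp_pair (ab_pow 2) (sumr_q ab_addq e01 e12) \; ab_add }.

Definition additive_bundle_morphism (E M E' M' : C)
    (q : hom E M) (q' : hom E' M')
    (A : additive_bundle q) (A' : additive_bundle q')
    (f1 : hom E E') (f0 : hom M M') : Prop :=
  exists e : f1 \; q' = q \; f0,
    ab_add A \; f1 = wp_map (ab_pow A 2) (ab_pow A' 2) e \; ab_add A' /\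
    ab_zero A \; f1 = f0 \; ab_zero A'.

End Pullbacks.

Section Preservation.
Variables (C D : category) (F : functor C D).

Definition preserves_pullback (A B M : C) (f : hom A M) (g : hom B M)
    (P : pullback f g) : Prop :=
  is_pullback (fmap F f) (fmap F g) (fmap F (pb_fst P)) (fmap F (pb_snd P)).

Definition map_pullback (A B M : C) (f : hom A M) (g : hom B M)
    (P : pullback f g) (FP : preserves_pullback P) :
    pullback (fmap F f) (fmap F g) :=
  Pullback FP.

Definition preserves_wide (n : nat) (E M : C) (q : hom E M)
    (W : wide_pullback n q) : Prop :=
  is_wide_pullback (fmap F q) (fmap F (wp_base W)) (fun i => fmap F (wp_pr W i)).

Definition map_wide (n : nat) (E M : C) (q : hom E M)
    (W : wide_pullback n q) (FW : preserves_wide W) : wide_pullback n (fmap F q) :=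
  WidePullback FW.

Section MapAdditive.
Variables (E M : C) (q : hom E M) (A : additive_bundle q).
Hypothesis FA : forall n, preserves_wide (ab_pow A n).

Let W n := map_wide (FA n).

Lemma fmap_wp_pair (Y : C) (u v : hom Y E) (e : u \; q = v \; q)
    (e' : fmap F u \; fmap F q = fmap F v \; fmap F q) :
  fmap F (wp_pair (ab_pow A 2) e) = wp_pair (W 2) e'.
Proof.
apply: (@wp_ext2 _ _ _ _ (W 2)); rewrite ?wp_pairK0 ?wp_pairK1.
- by rewrite -[RHS](congr1 (fmap F) (wp_pairK0 (ab_pow A 2) e)) fmapM.
- by rewrite -[RHS](congr1 (fmap F) (wp_pairK1 (ab_pow A 2) e)) fmapM.
Qed.

Lemma fmap_add_pair (Y : C) (u v : hom Y E) (e : u \; q = v \; q)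
    (u' v' : hom (F Y) (F E)) (e' : u' \; fmap F q = v' \; fmap F q) :
  fmap F u = u' -> fmap F v = v' ->
  fmap F (wp_pair (ab_pow A 2) e \; ab_add A) =
  wp_pair (W 2) e' \; fmap F (ab_add A).
Proof.
by move=> eu ev; subst u' v'; rewrite fmapM (fmap_wp_pair _ e').
Qed.

Lemma map_addq : fmap F (ab_add A) \; fmap F q = wp_base (W 2).
Proof. by rewrite -fmapM ab_addq. Qed.

Lemma map_zeroq : fmap F (ab_zero A) \; fmap F q = idm (F M).
Proof. by rewrite -fmapM ab_zeroq fmap1. Qed.

Lemma map_addC :
  wp_pair (W 2) (esym (wp_pr01 (W 2))) \; fmap F (ab_add A) = fmap F (ab_add A).
Proof. by rewrite -[in RHS]ab_addC; symmetry; apply: fmap_add_pair. Qed.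

Lemma map_add0 : wp_pair (W 2) (unit_q map_zeroq) \; fmap F (ab_add A) = idm (F E).
Proof.
rewrite -[RHS]fmap1 -[in RHS](ab_add0 A); symmetry.
by apply: fmap_add_pair; rewrite ?fmapM ?fmap1.
Qed.

Lemma map_addA :
  let e01 := wp_prqE (W 3) ord0 (Ordinal (isT : 1 < 3)) in
  let e12 := wp_prqE (W 3) (Ordinal (isT : 1 < 3)) ord_max in
  wp_pair (W 2) (suml_q (W := W 2) map_addq e01 e12) \; fmap F (ab_add A) =
  wp_pair (W 2) (sumr_q (W := W 2) map_addq e01 e12) \; fmap F (ab_add A).
Proof.
move=> e01 e12; have /(congr1 (fmap F)) h := ab_addA A.
etransitivity; last (etransitivity; first exact: h).
  by symmetry; apply: fmap_add_pair => //; apply: fmap_add_pair.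
by apply: fmap_add_pair => //; apply: fmap_add_pair.
Qed.

(* [(F(q), F(+_q), F(0_q))], with fibre powers [F(E_n)]. *)
Definition map_additive : additive_bundle (fmap F q) :=
  AdditiveBundle map_addC map_add0 map_addA.

End MapAdditive.
End Preservation.

(* The vertical lift [mu = <pi_0 lambda, pi_1 0> T(+_q) : E_2 -> T E] of a bundle
   [q : E -> M] with lift [lambda], for a functor [T] and maps [zE : E -> T E],
   [zM : M -> T M] playing the role of the zeros of [T]. *)
Section VerticalLift.
Variables (C : category) (T : functor C C) (E M : C) (q : hom E M).
Variables (A : additive_bundle q) (TA : forall n, preserves_wide T (ab_pow A n)).
Variables (lam zE : hom E (T E)) (zM : hom M (T M)).
Hypothesis lamq :
  additive_bundle_morphism A (map_additive TA) lam zM.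
Hypothesis zq : zE \; fmap T q = q \; zM.

Lemma vertical_lift_subproof :
  (wp_pr0 (ab_pow A 2) \; lam) \; fmap T q =
  (wp_pr1 (ab_pow A 2) \; zE) \; fmap T q.
Proof. by case: lamq => e _; rewrite -!compmA e zq !compmA wp_pr01. Qed.

Definition vertical_lift : hom (ab_pow A 2) (T E) :=
  wp_pair (map_wide (TA 2)) vertical_lift_subproof \; fmap T (ab_add A).

End VerticalLift.

(* In [tpow_pres] and [tuniv] the case [k = 0] is the plain universal property,
   and for [k = 1] [iter_functor tT 1] is convertible to [tT] on objects and maps.
   [tzero_nat] and [tadd_nat] are the naturality of [0] and [+]. *)
Record tangent_category := TangentCategory {
  tc_cat :> category;
  tT : functor tc_cat tc_cat;
  tp : nattrans tT (id_functor tc_cat);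
  tbundle : forall M, additive_bundle (tp M);
  tpow_pres : forall k M n,
    preserves_wide (iter_functor tT k) (ab_pow (tbundle M) n);
  tzero_nat : forall M N (f : hom M N),
    ab_zero (tbundle M) \; fmap tT f = f \; ab_zero (tbundle N);
  tadd_nat : forall M N (f : hom M N),
    ab_add (tbundle M) \; fmap tT f =
    wp_map (ab_pow (tbundle M) 2) (ab_pow (tbundle N) 2) (esym (nt_nat tp f))
      \; ab_add (tbundle N);
  tell : nattrans tT (comp_functor tT tT);
  tc : nattrans (comp_functor tT tT) (comp_functor tT tT);
  tell_additive : forall M,
    additive_bundle_morphism (tbundle M) (map_additive (F := tT) (tpow_pres 1 M))
      (tell M) (ab_zero (tbundle M));
  tc_additive : forall M,
    additive_bundle_morphism (map_additive (F := tT) (tpow_pres 1 M)) (tbundle (tT M))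
      (tc M) (idm (tT M));
  tcc : forall M, tc M \; tc M = idm (tT (tT M));
  tell_c : forall M, tell M \; tc M = tell M;
  tell_ell : forall M, tell M \; tell (tT M) = tell M \; fmap tT (tell M);
  tc_yb : forall M,
    fmap tT (tc M) \; tc (tT M) \; fmap tT (tc M) =
    tc (tT M) \; fmap tT (tc M) \; tc (tT M);
  tell_cc : forall M,
    tell (tT M) \; fmap tT (tc M) \; tc (tT M) = tc M \; fmap tT (tell M);
  tuniv : forall k M, let Tk := iter_functor tT k in
    is_pullback (fmap Tk (fmap tT (tp M))) (fmap Tk (ab_zero (tbundle M)))
      (fmap Tk (vertical_lift (tell_additive M) (tzero_nat (tp M))))
      (fmap Tk (wp_base (ab_pow (tbundle M) 2))) }.

Arguments tT {t}.
Arguments tp {t}.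
Arguments tbundle {t} M.
Arguments tell {t}.
Arguments tc {t}.

Definition tpow (X : tangent_category) (k : nat) : functor X X :=
  iter_functor tT k.

Definition tzero (X : tangent_category) (M : X) : hom M (tT M) :=
  ab_zero (tbundle M).

Record differential_bundle (X : tangent_category) (E M : X) (q : hom E M) :=
  DifferentialBundle {
  db_add :> additive_bundle q;
  db_lift : hom E (tT E);
  db_pow_pres : forall k n, preserves_wide (tpow X k) (ab_pow db_add n);
  db_pullback : forall n m,
    exists P : pullback (wp_base (ab_pow db_add n))
                        (wp_base (ab_pow (tbundle M) m)),
    forall k, preserves_pullback (tpow X k) P;
  db_lift_additive :
    additive_bundle_morphism db_add (map_additive (F := tT) (db_pow_pres 1))
      db_lift (tzero M);
  db_lift_additive' :
    additive_bundle_morphism db_add (tbundle E) db_lift (ab_zero db_add);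
  db_univ : forall k,
    is_pullback (fmap (tpow X k) (fmap tT q)) (fmap (tpow X k) (tzero M))
      (fmap (tpow X k) (vertical_lift db_lift_additive (tzero_nat q)))
      (fmap (tpow X k) (wp_base (ab_pow db_add 2)));
  db_lift_ell : db_lift \; tell E = db_lift \; fmap tT db_lift }.

Definition inverse (C : category) (A B : C) (f : hom A B) (g : hom B A) : Prop :=
  f \; g = idm A /\ g \; f = idm B.

Section Isos.
Variable C : category.

Lemma fmap_inverse (D : category) (F : functor C D) (A B : C) (f : hom A B) g :
  inverse f g -> inverse (fmap F f) (fmap F g).
Proof. by case=> fg gf; split; rewrite -fmapM ?fg ?gf fmap1. Qed.

Lemma inverse1 (A : C) : inverse (idm A) (idm A).
Proof. by split; rewrite comp1m. Qed.

Lemma is_pullback_iso (A B M P A' B' M' : C)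
    (f : hom A M) (g : hom B M) (p0 : hom P A) (p1 : hom P B)
    (f' : hom A' M') (g' : hom B' M')
    (a : hom A A') a' (b : hom B B') b' (m : hom M M') m' :
  inverse a a' -> inverse b b' -> inverse m m' ->
  f \; m = a \; f' -> g \; m = b \; g' ->
  is_pullback f g p0 p1 -> is_pullback f' g' (p0 \; a) (p1 \; b).
Proof.
move=> [aa a'a] [bb b'b] [mm m'm] ef eg [eP uP]; split.
  by rewrite -!compmA -ef -eg !compmA eP.
move=> Y u v e.
have ef' : a' \; f = f' \; m' by rewrite -[LHS]compm1 -mm -compmA [f \; _]compmA ef !compmA a'a comp1m.
have eg' : b' \; g = g' \; m' by rewrite -[LHS]compm1 -mm -compmA [g \; _]compmA eg !compmA b'b comp1m.
have e' : (u \; a') \; f = (v \; b') \; g.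
  by rewrite -!compmA ef' eg' !compmA e.
have [h [[h0 h1] hu]] := uP _ _ _ e'.
exists h; split.
  by rewrite !compmA h0 h1 -!compmA a'a b'b !compm1.
move=> k [k0 k1]; apply: hu.
by rewrite -k0 -k1 -!compmA aa bb !compm1.
Qed.

Lemma is_pullbackC (A B M P : C) (f : hom A M) (g : hom B M)
    (p0 : hom P A) (p1 : hom P B) :
  is_pullback f g p0 p1 -> is_pullback g f p1 p0.
Proof.
move=> [eP uP]; split=> // Y u v e; have [h [[h0 h1] hu]] := uP _ _ _ (esym e).
by exists h; split=> // k [k1 k0]; apply: hu.
Qed.

Lemma is_pullback_apex (A B M P Q : C)
    (f : hom A M) (g : hom B M) (p0 : hom P A) (p1 : hom P B)
    (a : hom Q P) a' :
  inverse a a' -> is_pullback f g p0 p1 -> is_pullback f g (a \; p0) (a \; p1).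
Proof.
move=> [aa a'a] [eP uP]; split; first by rewrite -!compmA eP.
move=> Y u v e; have [h [[h0 h1] hu]] := uP _ _ _ e.
exists (h \; a'); split.
  by rewrite !compmA -![(h \; a') \; a]compmA a'a compm1.
move=> k [k0 k1]; rewrite (hu (k \; a)); first by rewrite -compmA aa compm1.
by rewrite -!compmA.
Qed.

Lemma pullback_inverse (A B M : C) (f : hom A M) (g : hom B M)
    (P Q : pullback f g) :
  exists (a : hom P Q) (a' : hom Q P),
    [/\ inverse a a', a \; pb_fst Q = pb_fst P & a \; pb_snd Q = pb_snd P].
Proof.
have [eP _] := pb_ok P; have [eQ _] := pb_ok Q.
exists (pb_pair Q eP), (pb_pair P eQ); split; rewrite ?pb_pairK0 ?pb_pairK1 //.
by split; apply: pb_ext; rewrite -!compmA ?pb_pairK0 ?pb_pairK1 comp1m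
  ?pb_pairK0 ?pb_pairK1.
Qed.

End Isos.

Lemma preserves_any (C D : category) (F : functor C D) (A B M : C)
    (f : hom A M) (g : hom B M) (P Q : pullback f g) :
  preserves_pullback F Q -> preserves_pullback F P.
Proof.
have [a [a' [ia e0 e1]]] := pullback_inverse P Q.
rewrite /preserves_pullback -e0 -e1 !fmapM.
exact: is_pullback_apex (fmap_inverse F ia).
Qed.

Section Morphisms.
Variable C : category.

(* The fibre power [E_1] is [E]. *)
Lemma wp1_inverse (E M : C) (q : hom E M) (W : wide_pullback 1 q) :
  exists s : hom E W, inverse (wp_pr W ord0) s.
Proof.
have e (i : 'I_1) : idm E \; q = q by rewrite comp1m.
exists (wp_lift W e); split; last by rewrite wp_liftK.
apply: wp_ext => [|i]; rewrite -compmA ?wp_liftKb ?wp_liftK ?compm1 comp1m ?wp_prq //.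
by rewrite (ord1 i).
Qed.

Lemma wp_map_id (n : nat) (E M E' M' : C) (q : hom E M) (q' : hom E' M')
    (W : wide_pullback n q) (W' : wide_pullback n q')
    (f1 : hom E E') (f0 : hom M M') (e : f1 \; q' = q \; f0)
    (g1 : hom E' E) (g0 : hom M' M) (e' : g1 \; q = q' \; g0) :
  f1 \; g1 = idm E -> f0 \; g0 = idm M ->
  wp_map W W' e \; wp_map W' W e' = idm W.
Proof.
move=> i1 i0; apply: wp_ext => [|i]; rewrite -compmA comp1m.
  by rewrite wp_mapKb compmA wp_mapKb -compmA i0 compm1.
by rewrite wp_mapK compmA wp_mapK -compmA i1 compm1.
Qed.

Lemma morphismI (E M E' M' : C) (q : hom E M) (q' : hom E' M')
    (A : additive_bundle q) (A' : additive_bundle q')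
    (f1 : hom E E') (f0 : hom M M') (h : hom (ab_pow A 2) (ab_pow A' 2)) :
  f1 \; q' = q \; f0 ->
  h \; wp_pr0 (ab_pow A' 2) = wp_pr0 (ab_pow A 2) \; f1 ->
  h \; wp_pr1 (ab_pow A' 2) = wp_pr1 (ab_pow A 2) \; f1 ->
  ab_add A \; f1 = h \; ab_add A' ->
  ab_zero A \; f1 = f0 \; ab_zero A' ->
  additive_bundle_morphism A A' f1 f0.
Proof.
move=> e h0 h1 eA ez; exists e; split=> //; rewrite eA; congr (_ \; _).
by apply: wp_ext2; rewrite ?h0 ?h1 [RHS]wp_mapK.
Qed.

Lemma morphismE (E M E' M' : C) (q : hom E M) (q' : hom E' M')
    (A : additive_bundle q) (A' : additive_bundle q')
    (f1 : hom E E') (f0 : hom M M') :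
  additive_bundle_morphism A A' f1 f0 ->
  [/\ f1 \; q' = q \; f0, ab_zero A \; f1 = f0 \; ab_zero A' &
  exists h : hom (ab_pow A 2) (ab_pow A' 2),
  [/\ h \; wp_pr0 (ab_pow A' 2) = wp_pr0 (ab_pow A 2) \; f1,
  h \; wp_pr1 (ab_pow A' 2) = wp_pr1 (ab_pow A 2) \; f1 &
  ab_add A \; f1 = h \; ab_add A']].
Proof.
case=> e [eA ez]; split=> //; exists (wp_map (ab_pow A 2) (ab_pow A' 2) e).
by split=> //; exact: wp_mapK.
Qed.

Lemma morphism_comp (E M E' M' E'' M'' : C)
    (q : hom E M) (q' : hom E' M') (q'' : hom E'' M'')
    (A : additive_bundle q) (A' : additive_bundle q') (A'' : additive_bundle q'')
    (f1 : hom E E') (f0 : hom M M') (g1 : hom E' E'') (g0 : hom M' M'') :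
  additive_bundle_morphism A A' f1 f0 -> additive_bundle_morphism A' A'' g1 g0 ->
  additive_bundle_morphism A A'' (f1 \; g1) (f0 \; g0).
Proof.
move=> /morphismE[ef zf [h [h0 h1 hA]]] /morphismE[eg zg [k [k0 k1 kA]]].
apply: (@morphismI _ _ _ _ _ _ _ _ _ _ (h \; k)).
- by rewrite -compmA eg !compmA ef.
- by rewrite -compmA k0 !compmA h0.
- by rewrite -compmA k1 !compmA h1.
- by rewrite compmA hA -!compmA kA.
- by rewrite compmA zf -!compmA zg.
Qed.

End Morphisms.

Lemma morphism_fmap (C D : category) (F : functor C D)
    (E M E' M' : C) (q : hom E M) (q' : hom E' M')
    (A : additive_bundle q) (A' : additive_bundle q')
    (FA : forall n, preserves_wide F (ab_pow A n))
    (FA' : forall n, preserves_wide F (ab_pow A' n))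
    (f1 : hom E E') (f0 : hom M M') :
  additive_bundle_morphism A A' f1 f0 ->
  additive_bundle_morphism (map_additive FA) (map_additive FA')
    (fmap F f1) (fmap F f0).
Proof.
move=> /morphismE[e z [h [h0 h1 hA]]].
apply: (@morphismI _ _ _ _ _ _ _ (map_additive FA) (map_additive FA') _ _ (fmap F h)).
- by rewrite -!fmapM e.
- by rewrite /wp_pr0 /= -!fmapM; congr fmap.
- by rewrite /wp_pr1 /= -!fmapM; congr fmap.
- by rewrite /= -!fmapM hA.
- by rewrite /= -!fmapM z.
Qed.

Section TangentFacts.
Variable X : tangent_category.

Lemma tc_p (M : X) : tc M \; tp (tT M) = fmap tT (tp M).
Proof. by case: (morphismE (tc_additive M)); rewrite compm1. Qed.

Lemma tc_Tp (M : X) : tc M \; fmap tT (tp M) = tp (tT M).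
Proof. by rewrite -tc_p compmA tcc comp1m. Qed.

Lemma Tzero_tc (M : X) : fmap tT (tzero M) \; tc M = tzero (tT M).
Proof. by case: (morphismE (tc_additive M)) => _; rewrite comp1m. Qed.

Lemma tzero_natE (M N : X) (f : hom M N) :
  tzero M \; fmap tT f = f \; tzero N.
Proof. exact: tzero_nat. Qed.

Lemma tell_Tp (M : X) : tell M \; fmap tT (tp M) = tp M \; tzero M.
Proof. by case: (morphismE (tell_additive M)). Qed.

Lemma tc_inverse (M : X) : inverse (tc M) (tc M).
Proof. by split; rewrite tcc. Qed.

Lemma Tpow_inverse (M : X) m :
  exists (a : hom (tT (ab_pow (tbundle M) m)) (ab_pow (tbundle (tT M)) m)) a',
    inverse a a' /\
    a \; wp_base (ab_pow (tbundle (tT M)) m) =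
      fmap tT (wp_base (ab_pow (tbundle M) m)).
Proof.
pose W := map_wide (tpow_pres 1 M m : preserves_wide tT _).
pose W' := ab_pow (tbundle (tT M)) m.
have e : tc M \; tp (tT M) = fmap tT (tp M) \; idm _ by rewrite tc_p compm1.
have e' : tc M \; fmap tT (tp M) = tp (tT M) \; idm _ by rewrite tc_Tp compm1.
exists (wp_map W W' e), (wp_map W' W e'); split; last exact: etrans (wp_mapKb W W' e) (compm1 _).
by split; [apply: (@wp_map_id _ _ _ _ _ _ _ _ W W') |
           apply: (@wp_map_id _ _ _ _ _ _ _ _ W' W)]; rewrite ?tcc ?comp1m.
Qed.

Lemma tc_nat_bundle (E M : X) (q : hom E M) (A : additive_bundle q)
    (A1 : forall n, preserves_wide tT (ab_pow A n))
    (A2 : forall n, preserves_wide tT (ab_pow (map_additive A1) n)) :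
  additive_bundle_morphism (map_additive A2) (map_additive A2) (tc E) (tc M).
Proof.
have nt (B B' : X) (f : hom B B') :
    tc B \; fmap tT (fmap tT f) = fmap tT (fmap tT f) \; tc B'.
  exact: (nt_nat tc f).
by apply: (@morphismI _ _ _ _ _ _ _ (map_additive A2) (map_additive A2) _ _
  (tc (ab_pow A 2))); do ?[exact: nt | exact: esym (nt _ _ _)].
Qed.

Section TangentBundle.
Variables (E M : X) (q : hom E M) (D : differential_bundle q).

Let TA := map_additive (db_pow_pres D 1 : forall n, preserves_wide tT _).
Let Tlam : hom (tT E) (tT (tT E)) := fmap tT (db_lift D) \; tc E.

Lemma Tdb_pow_pres k n : preserves_wide (tpow X k) (ab_pow TA n).
Proof. exact: (db_pow_pres D k.+1 n). Qed.

Lemma Tdb_pullback n m :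
  exists P : pullback (wp_base (ab_pow TA n))
                      (wp_base (ab_pow (tbundle (tT M)) m)),
  forall k, preserves_pullback (tpow X k) P.
Proof.
have [P PP] := db_pullback D n m.
have [a [a' [ia ea]]] := Tpow_inverse M m.
have e0 : fmap tT (wp_base (ab_pow D n)) \; idm _ = idm _ \; wp_base (ab_pow TA n).
  by rewrite compm1 comp1m.
have e1 : fmap tT (wp_base (ab_pow (tbundle M) m)) \; idm _ =
    a \; wp_base (ab_pow (tbundle (tT M)) m) by rewrite compm1 ea.
have H1 := is_pullback_iso (inverse1 _) ia (inverse1 _) e0 e1 (PP 1).
exists (Pullback H1) => k.
rewrite /preserves_pullback /= 2!fmapM.
have im (B B' : X) (f : hom B B') f' := @fmap_inverse _ _ (tpow X k) B B' f f'.
apply: is_pullback_iso (im _ _ _ _ (inverse1 _)) (im _ _ _ _ ia)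
  (im _ _ _ _ (inverse1 _)) _ _ (PP k.+1); rewrite -!fmapM; congr fmap.
- exact: e0.
- exact: e1.
Qed.

Lemma Tdb_lift_additive :
  additive_bundle_morphism TA (map_additive (F := tT) (Tdb_pow_pres 1))
    Tlam (tzero (tT M)).
Proof.
rewrite -Tzero_tc; apply: morphism_comp (tc_nat_bundle _).
exact: morphism_fmap (db_lift_additive D).
Qed.

Lemma Tdb_lift_additive' :
  additive_bundle_morphism TA (tbundle (tT E)) Tlam (ab_zero TA).
Proof.
rewrite -[ab_zero TA]compm1; apply: morphism_comp (tc_additive E).
exact: morphism_fmap (db_lift_additive' D).
Qed.

Lemma T_vertical_lift :
  vertical_lift Tdb_lift_additive (tzero_nat (fmap tT q)) =
  fmap tT (vertical_lift (db_lift_additive D) (tzero_nat q)) \; tc E.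
Proof.
pose W2 := map_wide (Tdb_pow_pres 1 2 : preserves_wide tT _).
pose W1 := map_wide (db_pow_pres D 1 2 : preserves_wide tT _).
have n0 : tc (ab_pow D 2) \; wp_pr0 W2 = fmap tT (wp_pr0 W1) \; tc E.
  exact: (nt_nat tc (wp_pr0 (ab_pow D 2))).
have n1 : tc (ab_pow D 2) \; wp_pr1 W2 = fmap tT (wp_pr1 W1) \; tc E.
  exact: (nt_nat tc (wp_pr1 (ab_pow D 2))).
have pE (u v : hom (ab_pow D 2) (tT E)) (e : u \; fmap tT q = v \; fmap tT q)
    (u' v' : hom (ab_pow TA 2) (tT (tT E)))
    (e' : u' \; fmap tT (fmap tT q) = v' \; fmap tT (fmap tT q)) :
    u' = fmap tT u \; tc E -> v' = fmap tT v \; tc E ->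
  wp_pair W2 e' = fmap tT (wp_pair W1 e) \; tc (ab_pow D 2).
  move=> eu ev; apply: wp_ext2; rewrite ?wp_pairK0 ?wp_pairK1 -[RHS]compmA.
    rewrite n0 compmA eu.
    by congr (_ \; _); rewrite -[in LHS](wp_pairK0 W1 e) fmapM.
  rewrite n1 compmA ev.
  by congr (_ \; _); rewrite -[in LHS](wp_pairK1 W1 e) fmapM.
rewrite /vertical_lift [in RHS]fmapM -[RHS]compmA.
rewrite -[_ \; tc E](nt_nat tc (ab_add D)) [RHS]compmA.
congr (_ \; _); apply: pE.
  by rewrite fmapM -compmA.
by rewrite fmapM -compmA [_ \; tc E]Tzero_tc.
Qed.

Lemma Tdb_univ k :
  is_pullback (fmap (tpow X k) (fmap tT (fmap tT q)))
    (fmap (tpow X k) (tzero (tT M)))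
    (fmap (tpow X k) (vertical_lift Tdb_lift_additive (tzero_nat (fmap tT q))))
    (fmap (tpow X k) (wp_base (ab_pow TA 2))).
Proof.
rewrite T_vertical_lift -[wp_base (ab_pow TA 2)]compm1 2!fmapM.
have im (B B' : X) (f : hom B B') f' := @fmap_inverse _ _ (tpow X k) B B' f f'.
apply: is_pullback_iso (im _ _ _ _ (tc_inverse E)) (im _ _ _ _ (inverse1 _))
  (im _ _ _ _ (tc_inverse M)) _ _ (db_univ D k.+1); rewrite -!fmapM.
- by congr fmap; exact: esym (nt_nat tc q).
- by congr fmap; rewrite Tzero_tc comp1m.
Qed.

Lemma Tdb_lift_ell : Tlam \; tell (tT E) = Tlam \; fmap tT Tlam.
Proof.
have cT : fmap tT (tc E) \; fmap tT (tc E) = idm _.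
  exact: (proj1 (fmap_inverse tT (tc_inverse E))).
have ey : fmap tT (tell E) \; tc (tT E) \; fmap tT (tc E) = tc E \; tell (tT E).
  have -> : fmap tT (tell E) = tc E \; tell (tT E) \; fmap tT (tc E) \; tc (tT E).
    by rewrite tell_cc compmA tcc comp1m.
  by rewrite -!compmA [tc (tT E) \; (tc (tT E) \; _)]compmA tcc comp1m cT !compm1.
have lE : fmap tT (db_lift D) \; fmap tT (tell E) =
    fmap tT (db_lift D) \; fmap tT (fmap tT (db_lift D)).
  by rewrite -[LHS]fmapM -[RHS]fmapM db_lift_ell.
have nE : tc E \; fmap tT (fmap tT (db_lift D)) =
    fmap tT (fmap tT (db_lift D)) \; tc (tT E) by exact: (nt_nat tc (db_lift D)).
rewrite /Tlam fmapM -[LHS]compmA -ey [LHS]compmA lE.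
by rewrite -[RHS]compmA [X in _ = _ \; X]compmA nE -!compmA.
Qed.

Definition tangent_differential_bundle : differential_bundle (fmap tT q) :=
  {| db_add := TA;
     db_lift := Tlam;
     db_pow_pres := Tdb_pow_pres;
     db_pullback := Tdb_pullback;
     db_lift_additive := Tdb_lift_additive;
     db_lift_additive' := Tdb_lift_additive';
     db_univ := Tdb_univ;
     db_lift_ell := Tdb_lift_ell |}.

Lemma db_fibre_pres (P : pullback (tp M) q) k : preserves_pullback (tpow X k) P.
Proof.
have [P0 PP] := db_pullback D 1 1.
have [s is_] := wp1_inverse (ab_pow D 1).
have [t it] := wp1_inverse (ab_pow (tbundle M) 1).
have e0 : wp_base (ab_pow D 1) \; idm _ = wp_pr (ab_pow D 1) ord0 \; q.
  by rewrite compm1 wp_prq.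
have e1 : wp_base (ab_pow (tbundle M) 1) \; idm _ =
    wp_pr (ab_pow (tbundle M) 1) ord0 \; tp M by rewrite compm1 wp_prq.
have H := is_pullbackC (is_pullback_iso is_ it (inverse1 _) e0 e1 (pb_ok P0)).
apply: (@preserves_any _ _ _ _ _ _ _ _ _ (Pullback H)).
rewrite /preserves_pullback /= 2!fmapM; apply: is_pullbackC.
have im (B B' : X) (f : hom B B') f' := @fmap_inverse _ _ (tpow X k) B B' f f'.
apply: is_pullback_iso (im _ _ _ _ is_) (im _ _ _ _ it)
  (im _ _ _ _ (inverse1 _)) _ _ (PP k); rewrite -!fmapM; congr fmap.
- exact: e0.
- exact: e1.
Qed.

Section Connection.
Variable P : pullback (tp M) q.

(* [T(T M x_M E)], as the pullback of [T(p_M)] and [T(q)]. *)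
Definition T_fibre : pullback (fmap tT (tp M)) (fmap tT q) :=
  map_pullback (F := tT) (db_fibre_pres P 1).

Lemma ell_x_zero_subproof :
  (pb_fst P \; tell M) \; fmap tT (tp M) = (pb_snd P \; tzero E) \; fmap tT q.
Proof.
have [eP _] := pb_ok P.
by rewrite -!compmA tell_Tp tzero_natE !compmA eP.
Qed.

Lemma zero_x_lift_subproof :
  (pb_fst P \; tzero (tT M)) \; fmap tT (tp M) =
  (pb_snd P \; db_lift D) \; fmap tT q.
Proof.
have [eP _] := pb_ok P; have [el _ _] := morphismE (db_lift_additive D).
by rewrite -!compmA el tzero_natE !compmA eP.
Qed.

Definition ell_x_zero : hom P T_fibre := pb_map T_fibre ell_x_zero_subproof.
Definition zero_x_lift : hom P T_fibre := pb_map T_fibre zero_x_lift_subproof.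

Record is_horizontal_connection (H : hom P (tT E)) : Prop := HorizontalConnection {
  hc_Tq : H \; fmap tT q = pb_fst P;
  hc_p : H \; tp E = pb_snd P;
  hc_ell : H \; tell E = ell_x_zero \; fmap tT H;
  hc_lift : H \; fmap tT (db_lift D) \; tc E = zero_x_lift \; fmap tT H }.

(* [c_M x 1], from [T^2 M x_(T M) T E] to [T(T M x_M E)]. *)
Variable P' : pullback (tp (tT M)) (fmap tT q).

Lemma c_x_one_subproof :
  (pb_fst P' \; tc M) \; fmap tT (tp M) = (pb_snd P' \; idm (tT E)) \; fmap tT q.
Proof. by have [eP _] := pb_ok P'; rewrite -compmA tc_Tp compm1 eP. Qed.

Definition c_x_one : hom P' T_fibre := pb_map T_fibre c_x_one_subproof.

End Connection.

End TangentBundle.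
End TangentFacts.

Arguments tangent_differential_bundle {X E M q} D.
Arguments is_horizontal_connection {X E M q} D P H.
Arguments c_x_one {X E M q} D P P'.

(* Main.v *)
From mathcomp Require Import ssreflect ssrfun.
Require Import Defs.

(** Write [th] for [c_M x 1] and [K] for [th ; T(H) ; c_E]. That [K] is a section
of [<T^2(q), p>] is the same property of [H] under [T], because [c] is an
involution exchanging [p_(T -)] with [T(p)].

The two linearity conditions have a common shape: a map [g = a x b] on the fibre
product and a map [r] on [T(E)] satisfy [H ; r = g ; T(H)]. Applying [T] to this
equation, and moving [c] past [T^2(H)] by naturality, gives
[T(H) ; T(r) ; c ; T(c) = T(g) ; c ; T(T(H) ; c)]. To turn it into the equation
for [K] two coherences suffice. On the codomain, [c ; r' = T(r) ; c ; T(c)], where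
[r'] is the map playing the role of [r] for [T(q)]: for the lift [ell] it is the
axiom relating [ell] and [c], and for the lift of [q] it is the Yang-Baxter
equation together with naturality of [c] ([tc_tell], [tc_T_lift]). On the domain,
[th ; T(g) ; c = g' ; T(th)] ([c_x_one_linear]): as [T^2] preserves the fibre
product it is checked on both factors, where it amounts to conditions on [a] and
on [b] that hold for [ell], [0] and the lift of [q]. *)

Local Open Scope cat_scope.

Section Flip.
Local Set Implicit Arguments.
Local Unset Strict Implicit.
Variable X : tangent_category.

Lemma tc_natE (A B : X) (f : hom A B) :
  tc A \; fmap tT (fmap tT f) = fmap tT (fmap tT f) \; tc B.
Proof. exact: (nt_nat tc f). Qed.

Lemma Ttc_Ttc (A : X) : fmap tT (tc A) \; fmap tT (tc A) = idm _.
Proof. by rewrite -fmapM tcc fmap1. Qed.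

(** [tell_cc] solved for [c ; ell], as [c] and [T(c)] are involutions; this is
what moves [ell] across the flip that ends [T(H) ; c]. *)
Lemma tc_tell (A : X) :
  tc A \; tell (tT A) = fmap tT (tell A) \; tc (tT A) \; fmap tT (tc A).
Proof.
have -> : fmap tT (tell A) =
    tc A \; tell (tT A) \; fmap tT (tc A) \; tc (tT A).
  by rewrite tell_cc compmA tcc comp1m.
rewrite -!compmA [tc (tT A) \; (tc (tT A) \; _)]compmA tcc comp1m.
by rewrite Ttc_Ttc compm1.
Qed.

Lemma tc_Ttell_tc (A : X) :
  tc A \; fmap tT (tell A) \; tc (tT A) = tell (tT A) \; fmap tT (tc A).
Proof. by rewrite compmA -tell_cc -!compmA tcc compm1. Qed.

(** The counterpart of [tc_tell] for the lift: if [l] is the lift of a bundle then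
[T(l) ; c] is that of its image under [T], and [T(T(l) ; c) ; c] that of its image
under [T^2]. The Yang-Baxter equation rearranges the three flips. *)
Lemma tc_T_lift (A : X) (l : hom A (tT A)) :
  tc A \; fmap tT (fmap tT l \; tc A) \; tc (tT A) =
  fmap tT (fmap tT l \; tc A) \; tc (tT A) \; fmap tT (tc A).
Proof. by rewrite fmapM -!compmA tc_yb !compmA tc_natE. Qed.

End Flip.

Section TangentConnection.
Local Set Implicit Arguments.
Local Unset Strict Implicit.
Variables (X : tangent_category) (E M : X) (q : hom E M).
Variable D : differential_bundle q.
Variables (P : pullback (tp M) q) (P' : pullback (tp (tT M)) (fmap tT q)).

Local Notation th := (c_x_one D P P').

Lemma c_x_oneK0 : th \; fmap tT (pb_fst P) = pb_fst P' \; tc M.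
Proof. exact: (pb_pairK0 (T_fibre D P)). Qed.

Lemma c_x_oneK1 : th \; fmap tT (pb_snd P) = pb_snd P'.
Proof. exact: etrans (pb_pairK1 (T_fibre D P) _) (compm1 _). Qed.

Lemma TT_fibre_ext (Y : X) (h k : hom Y (tT (tT P))) :
  h \; fmap tT (fmap tT (pb_fst P)) = k \; fmap tT (fmap tT (pb_fst P)) ->
  h \; fmap tT (fmap tT (pb_snd P)) = k \; fmap tT (fmap tT (pb_snd P)) ->
  h = k.
Proof. exact: (@pb_ext _ _ _ _ _ _ (map_pullback (db_fibre_pres D P 2))). Qed.

(** Equality of maps into [T^2] of the fibre product, tested on the two factors;
the flip on the first factor of [c_M x 1] conjugates [T(a)] by [c]. *)
Lemma c_x_one_linear (a : hom (tT M) (tT (tT M))) (b : hom E (tT E))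
    (a' : hom (tT (tT M)) (tT (tT (tT M)))) (b' : hom (tT E) (tT (tT E)))
    (g : hom P (tT P)) (g' : hom P' (tT P')) :
  g \; fmap tT (pb_fst P) = pb_fst P \; a ->
  g \; fmap tT (pb_snd P) = pb_snd P \; b ->
  g' \; fmap tT (pb_fst P') = pb_fst P' \; a' ->
  g' \; fmap tT (pb_snd P') = pb_snd P' \; b' ->
  tc M \; fmap tT a \; tc (tT M) = a' \; fmap tT (tc M) ->
  fmap tT b \; tc E = b' ->
  th \; fmap tT g \; tc P = g' \; fmap tT th.
Proof.
move=> g0 g1 g'0 g'1 ea eb; apply: TT_fibre_ext; rewrite -!compmA tc_natE.
  rewrite [fmap tT g \; _]compmA -!fmapM g0 c_x_oneK0 !fmapM.
  by rewrite !compmA c_x_oneK0 g'0 -!compmA -ea !compmA.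
by rewrite [fmap tT g \; _]compmA -!fmapM g1 c_x_oneK1 fmapM -compmA eb
           compmA c_x_oneK1 g'1.
Qed.

(** Both linearity conditions on a connection are equations [H r = g T(H)]; this
is how such an equation passes from [H] to the induced map on [T(q)]. *)
Lemma tangent_map_linear (H : hom P (tT E))
    (r : hom (tT E) (tT (tT E))) (r' : hom (tT (tT E)) (tT (tT (tT E))))
    (g : hom P (tT P)) (g' : hom P' (tT P')) :
  H \; r = g \; fmap tT H ->
  tc E \; r' = fmap tT r \; tc (tT E) \; fmap tT (tc E) ->
  th \; fmap tT g \; tc P = g' \; fmap tT th ->
  (th \; fmap tT H \; tc E) \; r' = g' \; fmap tT (th \; fmap tT H \; tc E).
Proof.
move=> eH er eth; rewrite !fmapM !compmA -eth -!compmA er.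
rewrite [tc P \; _]compmA tc_natE; congr (_ \; _).
by rewrite !compmA -!fmapM eH fmapM.
Qed.

Lemma ell_x_zeroK0 :
  ell_x_zero D P \; fmap tT (pb_fst P) = pb_fst P \; tell M.
Proof. exact: (pb_pairK0 (T_fibre D P)). Qed.

Lemma ell_x_zeroK1 :
  ell_x_zero D P \; fmap tT (pb_snd P) = pb_snd P \; tzero E.
Proof. exact: (pb_pairK1 (T_fibre D P)). Qed.

Lemma zero_x_liftK0 :
  zero_x_lift D P \; fmap tT (pb_fst P) = pb_fst P \; tzero (tT M).
Proof. exact: (pb_pairK0 (T_fibre D P)). Qed.

Lemma zero_x_liftK1 :
  zero_x_lift D P \; fmap tT (pb_snd P) = pb_snd P \; db_lift D.
Proof. exact: (pb_pairK1 (T_fibre D P)). Qed.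

End TangentConnection.

Theorem proposition4p9 (X : tangent_category) (E M : X) (q : hom E M)
    (D : differential_bundle q)
    (P : pullback (tp M) q) (H : hom P (tT E))
    (P' : pullback (tp (tT M)) (fmap tT q)) :
  is_horizontal_connection D P H ->
  is_horizontal_connection (tangent_differential_bundle D) P'
    (c_x_one D P P' \; fmap tT H \; tc E).
Proof.
case=> HTq Hp Hell Hlift; set TD := tangent_differential_bundle D; split.
- rewrite -!compmA tc_natE [fmap tT H \; _]compmA -fmapM HTq compmA c_x_oneK0.
  by rewrite -compmA tcc compm1.
- by rewrite -!compmA tc_p -fmapM Hp c_x_oneK1.
- apply: (tangent_map_linear Hell (tc_tell E)).
  apply: (c_x_one_linear D (ell_x_zeroK0 D P) (ell_x_zeroK1 D P)
    (ell_x_zeroK0 TD P') (ell_x_zeroK1 TD P')).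
  + exact: tc_Ttell_tc.
  + exact: Tzero_tc.
- apply: (tangent_map_linear Hlift (tc_T_lift (db_lift D))).
  apply: (c_x_one_linear D (zero_x_liftK0 D P) (zero_x_liftK1 D P)
    (zero_x_liftK0 TD P') (zero_x_liftK1 TD P')) => //.
  by rewrite Tzero_tc tzero_natE.
Qed.
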